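(* Let $\Phi$ be a stationary point process in $\mathbb{R}^d$ of unit intensity which is sub-Poisson with respect to void probabilities, i.e. $\mathbb{P}\{\Phi(B)=0\}\le e^{-|B|}$ for every bounded Borel set $B\subset\mathbb{R}^d$. Then there exists $C_d>0$ such that for $r_n\ge C_d(\log n)^{1/d}$, with high probability (i.e. with probability tending to $1$ as $n\to\infty$) $C(\Phi_n,r_n)$ is contractible and $\chi(C(\Phi_n,r_n))=1$.
   Context: A point process $\Phi$ in $\mathbb{R}^d$ is a random locally finite counting measure, assumed simple and identified with its random set of points; $\Phi(B)$ is the number of points in $B$; $|B|$ is Lebesgue measure. Stationary means translation invariant in law; unit intensity means $\mathbb{E}\{\Phi(B)\}=|B|$. $W_n=[-n^{1/d}/2,n^{1/d}/2]^d$ and $\Phi_n=\Phi\cap W_n$. $B_x(r)$ is the ball of radius $r$ centred at $x$. For a finite point set $P$ and $\varepsilon>0$, the Čech complex $C(P,\varepsilon)$ is the abstract simplicial complex with vertex set $P$ whose $m$-simplices are the subsets $\{x_{i_0},\ldots,x_{i_m}\}\subset P$ with $\bigcap_l B_{x_{i_l}}(\varepsilon/2)\ne\varnothing$. The Euler characteristic is $\chi(C(P,r))=\sum_{k\ge0}(-1)^k\beta_k(C(P,r))$, where $\beta_k$ is the $k$th Betti number (homology over $\mathbb{Z}_2$). *)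

(* Defs.v *)
From mathcomp Require Import all_boot all_order all_algebra finmap.
From mathcomp Require Import all_classical all_reals all_analysis.
Import Order.TTheory GRing.Theory Num.Theory numFieldNormedType.Exports.

Set Implicit Arguments.
Unset Strict Implicit.
Unset Printing Implicit Defensive.

Local Open Scope classical_set_scope.
Local Open Scope ring_scope.

Section EuclideanSpace.
Variables (R : realType) (d : nat).
Implicit Types (x y : 'rV[R]_d) (A B : set 'rV[R]_d).

(* The library norm on row vectors is the sup norm, hence this definition. *)
Definition enorm x : R := Num.sqrt (\sum_(i < d) x 0 i ^+ 2).

Definition eball x (r : R) : set 'rV[R]_d := [set y | enorm (y - x) <= r].

Definition window (n : nat) : set 'rV[R]_d :=
  [set x | forall i, `|x 0 i| <= n%:R `^ (d%:R^-1) / 2].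

Definition borel : set (set 'rV[R]_d) := <<s [set U : set 'rV[R]_d | open U] >>.

Definition bounded_borel : set (set 'rV[R]_d) := borel `&` bounded_set.

Definition locally_finite A : Prop :=
  forall B, bounded_set B -> finite_set (A `&` B).

Definition translate x A : set 'rV[R]_d := [set y + x | y in A].

(* The sigma-algebra on sets of points generated by the maps
   phi |-> phi(B), B bounded Borel. *)
Definition count_events : set (set (set 'rV[R]_d)) :=
  [set E | exists B (k : nat), bounded_borel B /\
     E = [set phi | counting (phi `&` B) = k%:R%:E :> \bar R]].

End EuclideanSpace.

Notation configuration R d := (g_sigma_algebraType (@count_events R d)).

(* d-dimensional Lebesgue measure of a Borel set, as the iterated product of
   the Lebesgue measure of the line (Cavalieri); on the one-point space R^0 it
   is the unit mass.  The value is meaningless outside Borel sets. *)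
Fixpoint volume (R : realType) (d : nat) : set 'rV[R]_d -> \bar R :=
  match d with
  | 0 => fun B => (\1_B (0 : 'rV[R]_0))%:E
  | d'.+1 => fun B => (\int[lebesgue_measure]_(t in [set: R])
      volume [set v : 'rV[R]_d' | B (row_mx (t%:M : 'rV[R]_1) v)])%E
  end.

Section PointProcess.
Context (R : realType) (d : nat) (disp : measure_display)
  (Omega : measurableType disp) (P : probability Omega R).

(* A simple point process, identified with its random set of points. *)
Record point_process := PointProcess {
  points :> {mfun Omega >-> configuration R d} ;
  points_locally_finite :
    forall omega, locally_finite (points omega : set 'rV[R]_d) }.

Variable Phi : point_process.

Definition count_in (B : set 'rV[R]_d) (omega : Omega) : \bar R :=
  counting ((Phi omega : set 'rV[R]_d) `&` B).

Definition stationary : Prop :=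
  forall (x : 'rV[R]_d) (E : set (configuration R d)), measurable E ->
    P [set omega | E (translate x (Phi omega))] = P [set omega | E (Phi omega)].

Definition unit_intensity : Prop :=
  forall B, borel B -> (\int[P]_omega count_in B omega)%E = volume B.

Definition sub_poisson_void : Prop :=
  forall B, bounded_borel B ->
    (P [set omega | count_in B omega = 0%E] <= expeR (- volume B))%E.

(* The points in the n-th window; fset_set A is the finite set A whenever A is
   finite, which local finiteness ensures here. *)
Definition window_points (n : nat) (omega : Omega) : {fset 'rV[R]_d} :=
  fset_set ((Phi omega : set 'rV[R]_d) `&` window n).

(* The events E n need not be known to be measurable; as for the library's
   "almost everywhere", the probability is that of a measurable event inside
   E n. For measurable E n this amounts to P (E n) --> 1. *)
Definition with_high_probability (E : nat -> set Omega) : Prop :=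
  exists A : nat -> set Omega,
    [/\ forall n, measurable (A n), forall n, A n `<=` E n &
        P (A n) @[n --> \oo] --> 1%E].

End PointProcess.

Section SimplicialComplex.
Variable V : finType.
Implicit Type K : {set {set V}}.

Definition simplices K (k : nat) : {set {set V}} :=
  [set s in K | #|s| == k.+1]%SET.

(* Matrix, acting on row vectors, of the boundary map from (k+1)-chains to
   k-chains over Z/2. *)
Definition boundary K (k : nat) :
    'M['F_2]_(#|simplices K k.+1|, #|simplices K k|) :=
  \matrix_(i, j) ((enum_val j : {set V}) \subset (enum_val i : {set V}))%:R.

Definition dim_cycles K (k : nat) : nat :=
  match k with
  | 0 => #|simplices K 0|
  | k'.+1 => \rank (kermx (boundary K k'))
  end.

Definition dim_boundaries K (k : nat) : nat := \rank (boundary K k).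

Definition betti K (k : nat) : nat := dim_cycles K k - dim_boundaries K k.

(* There are no k-simplices, hence no homology, for k >= #|V|. *)
Definition euler_characteristic K : int :=
  \sum_(k < #|V|) (-1) ^+ k * (betti K k)%:Z.

(* Geometric realization in barycentric coordinates. *)
Definition realization (R : realType) K : set 'rV[R]_#|V| :=
  [set w | [/\ forall i, 0 <= w 0 i, \sum_i w 0 i = 1 &
      [set v : V | w 0 (enum_rank v) != 0]%SET \in K]].

End SimplicialComplex.

Arguments realization {V} R K.

Definition contractible (R : realType) (T : topologicalType) (X : set T) :=
  exists (x0 : T) (H : R * T -> T),
    [/\ X x0,
        {within `[0 : R, 1]%classic `*` X, continuous H},
        forall (t : R) x, 0 <= t <= 1 -> X x -> X (H (t, x)) &
        forall x, X x -> H (0, x) = x /\ H (1, x) = x0].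

Definition contractible_complex (R : realType) (V : finType)
    (K : {set {set V}}) : Prop :=
  contractible R (realization R K).

Definition cech (R : realType) (d : nat) (A : {fset 'rV[R]_d}) (eps : R) :
    {set {set A}} :=
  [set s : {set A} | (s != finset.set0) &&
    `[< exists y, forall x : A, x \in s -> eball (val x) (eps / 2) y >]]%SET.

(* Main.v *)
Require Import Defs.
From mathcomp Require Import all_boot all_order all_algebra finmap.
From mathcomp Require Import all_classical all_reals all_analysis.
From mathcomp Require Import ring lra.
Import Order.TTheory GRing.Theory Num.Theory numFieldNormedType.Exports.

Set Implicit Arguments.
Unset Strict Implicit.
Unset Printing Implicit Defensive.

Local Open Scope ring_scope.
Local Open Scope classical_set_scope.

(** Let [ln n >= 1] and cut the window into a grid of cells of volume at least
    [2 * ln n] and of side of order [(ln n)^(1/d)].  There are at most [n] of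
    them and each is empty of points with probability at most [n^-2], so by the
    union bound ([void_cells_le]) every cell contains a point with probability
    at least [1 - 1/n].  When that happens and [r n] is large compared with the
    cell diameter, the open balls of radius [r n / 2] around the points cover
    the window, and the rest is deterministic ([cech_dense]).

    Clipping coordinates to the window moves no point away from a centre in
    the window, so the Cech complex is also the nerve [K] of the sets
    ball-intersected-with-window: a finite cover of a compact convex set [W]
    by compact convex sets [C v].  Two facts about such nerves are needed.

    Contractibility ([contractible_nerve]).  There are continuous maps
    [to_space : |K| -> W] and [to_nerve : W -> |K|].  The second is a partition
    of unity [u] supported in the cover.  The first averages chosen points of
    the intersections [C_s], with a weight on [s] that vanishes unless [s]
    contains every vertex where [w] is large and is contained in the support
    of [w].  Let [trim w] keep only the large coordinates of [w].  Then [w] and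
    [trim w] lie in the common simplex [supp w], while [trim w] and
    [to_nerve (to_space w)] lie in the common simplex of all [v] with
    [to_space w] in [C v].  Hence the identity is homotopic, by straight lines
    inside simplices, to [to_nerve \o to_space], which contracts because [W]
    is convex.

    Euler characteristic ([euler_nerve]).  By rank-nullity the alternating sum
    of the Betti numbers is the alternating count of the simplices
    ([euler_poincare]).  For that count, inclusion-exclusion says that the
    indicator of [W] minus the alternating sum of the indicators of the [C_s]
    vanishes identically, and Hadwiger's argument shows that a linear relation
    between indicators of compact convex sets persists when every nonempty
    set is replaced by [1] ([euler_valuation]). *)

(** * Convex combinations *)

Section WeightedAverage.
Variables (R : realType) (E : normedModType R).

Definition lerp (t : R) (x y : E) : E := (1 - t) *: x + t *: y.

Lemma lerp0 x y : lerp 0 x y = x.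
Proof. by rewrite /lerp subr0 scale1r scale0r addr0. Qed.

Lemma lerp1 x y : lerp 1 x y = y.
Proof. by rewrite /lerp subrr scale1r scale0r add0r. Qed.

Definition convex (A : set E) :=
  forall x y t, A x -> A y -> 0 <= t <= 1 -> A (lerp t x y).

Definition wavg (I : finType) (u : I -> R) (p : I -> E) : E :=
  (\sum_i u i)^-1 *: \sum_i u i *: p i.

Lemma convexI (A B : set E) : convex A -> convex B -> convex (A `&` B).
Proof. by move=> cA cB x y t [? ?] [? ?] t01; split; [apply: cA|apply: cB]. Qed.

(** Points of zero weight may lie outside [A]: this is what lets a weight steer
    the average into a set that contains only some of the points. *)
Lemma convex_wavg (I : finType) (u : I -> R) (p : I -> E) (A : set E) :
  convex A -> (forall i, 0 <= u i) -> 0 < \sum_i u i ->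
  (forall i, 0 < u i -> A (p i)) -> A (wavg u p).
Proof.
move=> cA u0 + Ap; rewrite /wavg.
elim: (index_enum I) => [|i s IH]; first by rewrite big_nil ltxx.
rewrite !big_cons; set S := \sum_(j <- s) u j; set x := \sum_(j <- s) _.
have S0 : 0 <= S by exact: sumr_ge0.
have := u0 i; rewrite le_eqVlt => /orP[/eqP <-|ui].
  by rewrite scale0r !add0r => /IH.
move: S0; rewrite le_eqVlt => /orP[/eqP S0 _|S0 uS].
  have x0 : x = 0.
    have /eqP := esym S0; rewrite psumr_eq0// => /allP us.
    by rewrite /x big_seq big1// => j /us /eqP ->; rewrite scale0r.
  by rewrite x0 -S0 !addr0 scalerA mulVf ?gt_eqF// scale1r; exact: Ap.
have -> : (u i + S)^-1 *: (u i *: p i + x) =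
    (1 - S / (u i + S)) *: p i + (S / (u i + S)) *: (S^-1 *: x).
  rewrite scalerDr !scalerA; congr (_ *: _ + _ *: _).
    by field; rewrite gt_eqF.
  by field; rewrite !gt_eqF.
apply: cA; [exact: Ap|exact: IH|].
rewrite divr_ge0 ?(ltW uS) ?(ltW S0)//=.
by rewrite ler_pdivrMr// mul1r lerDr ltW.
Qed.

Lemma continuous_wavg (T : topologicalType) (I : finType) (u : I -> T -> R)
    (p : I -> E) (x : T) :
  (forall i, {for x, continuous (u i)}) -> \sum_i u i x != 0 ->
  {for x, continuous (fun y => wavg (u^~ y) p)}.
Proof.
move=> cu Sx; apply: cvgZ.
  apply: cvgV => //.
  by apply: cvg_big => [|i _]; [exact: add_continuous|exact: cu].
apply: cvg_big => [|i _]; first exact: add_continuous.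
by apply: cvgZ; [exact: cu|exact: cvg_cst].
Qed.

End WeightedAverage.

(** * Continuity of elementary operations *)

Lemma continuous_pos_part (R : realType) (T : topologicalType) (f : T -> R) x :
  {for x, continuous f} -> {for x, continuous (fun y => Num.max 0 (f y))}.
Proof.
by move=> cf; apply: (@continuous_max R T (cst 0)) => //; exact: cvg_cst.
Qed.

Lemma continuous_subl (R : realType) (T : topologicalType) (f : T -> R) (a : R) x :
  {for x, continuous f} -> {for x, continuous (fun y => f y - a)}.
Proof. by move=> cf; apply: cvgB => //; exact: cvg_cst. Qed.

Lemma continuous_subr (R : realType) (T : topologicalType) (f : T -> R) (a : R) x :
  {for x, continuous f} -> {for x, continuous (fun y => a - f y)}.
Proof. by move=> cf; apply: cvgB => //; exact: cvg_cst. Qed.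

Lemma continuous_scale (R : realType) (T : topologicalType) (f : T -> R) (a : R) x :
  {for x, continuous f} -> {for x, continuous (fun y => a * f y)}.
Proof. by move=> cf; apply: cvgM => //; exact: cvg_cst. Qed.

Lemma continuous_lerp (R : realType) (E : normedModType R) (T : topologicalType)
    (s : T -> R) (f g : T -> E) x :
  {for x, continuous s} -> {for x, continuous f} -> {for x, continuous g} ->
  {for x, continuous (fun y => lerp (s y) (f y) (g y))}.
Proof.
by move=> cs cf cg; apply: cvgD; apply: cvgZ => //; exact: continuous_subr.
Qed.

Lemma continuous_prod (R : realType) (T : topologicalType) (I : finType)
    (P : pred I) (F : I -> T -> R) x :
  (forall i, {for x, continuous (F i)}) ->
  {for x, continuous (fun y => \prod_(i | P i) F i y)}.
Proof.
by move=> cF; apply: cvg_big => [|i _]; [exact: mul_continuous|exact: cF].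
Qed.

(** * Contractibility of the nerve of a convex cover *)

Section Nerve.
Variables (R : realType) (E : normedModType R) (V : finType).
Variables (W : set E) (C : V -> set E) (u : V -> E -> R).
Hypotheses (cvxW : convex W) (cvxC : forall v, convex (C v)).

Definition vertex (v : V) : 'rV[R]_#|V| := delta_mx 0 (enum_rank v).

(** The simplex of the full barycentric space spanned by [s], whether or not [s]
    belongs to a complex; it is empty for empty [s]. *)
Definition face (s : {set V}) : set 'rV[R]_#|V| :=
  [set w | [/\ forall i, 0 <= w 0 i, \sum_i w 0 i = 1 &
    forall v, v \notin s -> w 0 (enum_rank v) = 0]].

Lemma convex_face s : convex (face s).
Proof.
move=> x y t [x0 x1 xs] [y0 y1 ys] /andP[t0 t1]; split.
- by move=> i; rewrite /lerp !mxE addr_ge0// mulr_ge0// subr_ge0.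
- under eq_bigr do rewrite /lerp !mxE.
  by rewrite big_split/= -!mulr_sumr x1 y1; ring.
- by move=> v vs; rewrite /lerp !mxE xs// ys// !mulr0 addr0.
Qed.

Lemma face_vertex (s : {set V}) v : v \in s -> face s (vertex v).
Proof.
move=> vs; split.
- by move=> i; rewrite mxE ler0n.
- rewrite (bigD1 (enum_rank v))//= big1 ?mxE ?eqxx ?addr0// => i /negbTE iv.
  by rewrite mxE iv andbF.
- move=> z zs; rewrite mxE eqxx/= (inj_eq enum_rank_inj).
  by case: eqP zs => // ->; rewrite vs.
Qed.

Definition supp (w : 'rV[R]_#|V|) : {set V} :=
  [set v : V | w 0 (enum_rank v) != 0]%SET.

Lemma face_supp (w : 'rV[R]_#|V|) : (forall i, 0 <= w 0 i) -> \sum_i w 0 i = 1 ->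
  face (supp w) w.
Proof.
by move=> w0 w1; split=> // v; rewrite inE negbK => /eqP.
Qed.

Definition common_point (s : {set V}) (y : E) := W y /\ forall v, v \in s -> C v y.

Variable K : {set {set V}}.
Hypothesis KE :
  forall s, reflect (s != finset.set0 /\ exists y, common_point s y) (s \in K).

(** Every point visited by the homotopy below lies in some [face s] to which
    this applies; [s] need not be nonempty since [face set0] is empty. *)
Lemma face_nerve s y : common_point s y -> face s `<=` realization R K.
Proof.
move=> [Wy Cy] w [w0 w1 ws]; split=> //; apply/KE; split.
  apply/eqP => w_eq0; have : \sum_i w 0 i = 0.
    rewrite big1// => i _; move/setP : w_eq0 => /(_ (enum_val i)).
    by rewrite !inE enum_valK => /negbT; rewrite negbK => /eqP.
  by rewrite w1 => /eqP; rewrite oner_eq0.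
exists y; split=> // v; rewrite inE => wv; apply: Cy.
by apply: contraNT wv => /ws ->.
Qed.

Hypothesis u_cont : forall v y, W y -> {for y, continuous (u v)}.
Hypothesis u_ge0 : forall v y, 0 <= u v y.
Hypothesis uC : forall v y, 0 < u v y -> C v y.
Hypothesis uW : forall y, W y -> exists v, 0 < u v y.
Variable y0 : E.
Hypothesis Wy0 : W y0.

(** Coordinates above [c] count as large.  Coordinates of a point of the
    realization sum to [1], so one of them is at least [1 / #|V|] and the
    factor two makes it exceed [c] strictly. *)
Let c : R := #|V|.*2%:R^-1.

(** A point of the intersection indexed by [s].  The default [y0] is harmless:
    over the realization, an empty intersection gets weight zero below. *)
Definition witness (s : {set V}) : E := xget y0 [set y | common_point s y].

(** Any nonnegative continuous function would do that vanishes unless [s] lies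
    in the support of [w] and contains all its large coordinates, as long as it
    is positive for some [s]; this one is positive for the support itself. *)
Definition weight (s : {set V}) (w : 'rV[R]_#|V|) : R :=
  (\prod_(v in s) w 0 (enum_rank v)) *
  \prod_(v | v \notin s) Num.max 0 (c - w 0 (enum_rank v)).

Definition to_space w : E := wavg (weight^~ w) witness.

Definition excess v (w : 'rV[R]_#|V|) : R := Num.max 0 (w 0 (enum_rank v) - c).

Definition trim w : 'rV[R]_#|V| := wavg (excess^~ w) vertex.

Definition to_nerve y : 'rV[R]_#|V| := wavg (u^~ y) vertex.

(** For [y] in [W] this is a simplex of the nerve, with [y] as witness. *)
Definition near_set y : {set V} := [set v | `[< C v y >]]%SET.

Lemma common_near y : W y -> common_point (near_set y) y.
Proof. by move=> Wy; split=> // v; rewrite inE => /asboolP. Qed.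

Lemma sum_u_gt0 y : W y -> 0 < \sum_v u v y.
Proof.
by move=> /uW[v uv]; rewrite (bigD1 v)//= ltr_pwDl// sumr_ge0.
Qed.

Lemma to_nerve_face y : W y -> face (near_set y) (to_nerve y).
Proof.
move=> Wy; apply: convex_wavg => [|v||v uv].
- exact: convex_face.
- exact: u_ge0.
- exact: sum_u_gt0.
- by apply: face_vertex; rewrite inE; apply/asboolP/uC.
Qed.

Section InRealization.
Variable w : 'rV[R]_#|V|.
Hypothesis wK : realization R K w.

Let w_ge0 i : 0 <= w 0 i. Proof. by case: wK. Qed.
Let w_sum : \sum_i w 0 i = 1. Proof. by case: wK. Qed.
Let w_supp : supp w \in K. Proof. by case: wK. Qed.

Let c_gt0 : 0 < c.
Proof.
rewrite invr_gt0 ltr0n double_gt0 lt0n; apply/negP => /eqP V0.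
have /KE[/set0Pn[v _] _] := w_supp.
by have := card0_eq V0 v; rewrite inE.
Qed.

Lemma realization_face : face (supp w) w.
Proof. exact: face_supp. Qed.

Lemma exists_excess : exists v, c < w 0 (enum_rank v).
Proof.
apply/existsP; apply: contraT; rewrite negb_exists => /forallP wc.
suff : \sum_i w 0 i <= 2^-1 by rewrite w_sum; lra.
apply: (@le_trans _ _ (\sum_(i < #|V|) c)).
  by apply: ler_sum => i _; have := wc (enum_val i); rewrite enum_valK -leNgt.
rewrite sumr_const card_ord -[_ *+ _]mulr_natl /c -muln2 natrM invfM.
have V0 : #|V|%:R != 0 :> R.
  by move: c_gt0; rewrite invr_gt0 ltr0n double_gt0 pnatr_eq0 lt0n.
by rewrite mulrA mulfV// mul1r.
Qed.

Lemma excess_ge0 v : 0 <= excess v w.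
Proof. by rewrite le_max lexx. Qed.

Lemma sum_excess_gt0 : 0 < \sum_v excess v w.
Proof.
have [v vc] := exists_excess; rewrite (bigD1 v)//= ltr_pwDl//.
  by rewrite lt_max subr_gt0 vc orbT.
by rewrite sumr_ge0// => z _; exact: excess_ge0.
Qed.

Lemma excess_gt0 v : 0 < excess v w -> c < w 0 (enum_rank v).
Proof. by rewrite lt_max ltxx subr_gt0. Qed.

Lemma trim_in (s : {set V}) :
  (forall v, c < w 0 (enum_rank v) -> v \in s) -> face s (trim w).
Proof.
move=> ws; apply: convex_wavg => [|||v /excess_gt0 vc].
- exact: convex_face.
- exact: excess_ge0.
- exact: sum_excess_gt0.
- exact/face_vertex/ws.
Qed.

Lemma trim_supp : face (supp w) (trim w).
Proof.
by apply: trim_in => v vc; rewrite inE gt_eqF// (lt_trans c_gt0).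
Qed.

Lemma weight_ge0 s : 0 <= weight s w.
Proof. by rewrite mulr_ge0// prodr_ge0// => v _; rewrite le_max lexx. Qed.

Lemma weight_supp : 0 < weight (supp w) w.
Proof.
rewrite mulr_gt0// prodr_gt0// => v; rewrite inE.
  by move=> w0; rewrite lt_def w0 w_ge0.
by rewrite negbK => /eqP ->; rewrite subr0 lt_max c_gt0 orbT.
Qed.

Lemma sum_weight_gt0 : 0 < \sum_s weight s w.
Proof.
rewrite (bigD1 (supp w))//= ltr_pwDl ?weight_supp// sumr_ge0// => s _.
exact: weight_ge0.
Qed.

Lemma weight_gt0 s : 0 < weight s w ->
  (s \subset supp w) /\ forall v, c < w 0 (enum_rank v) -> v \in s.
Proof.
move=> ws; split.
  apply/fintype.subsetP => v vs; rewrite inE; apply: contraTneq ws => wv.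
  by rewrite /weight (bigD1 v)//= wv !mul0r ltxx.
move=> v vc; apply: contraTT ws => vs.
rewrite /weight [X in _ * X](bigD1 v)//= max_l ?subr_le0 ?(ltW vc)//.
by rewrite mul0r mulr0 ltxx.
Qed.

Lemma common_witness (s : {set V}) : s \subset supp w -> common_point s (witness s).
Proof.
move=> sw; rewrite /witness; case: xgetP => [y ->//|].
have /KE[_ [y [Wy Cy]]] := w_supp => /(_ y)[]; split=> // v vs.
exact/Cy/(fintype.subsetP sw).
Qed.

Lemma to_space_W : W (to_space w).
Proof.
apply: convex_wavg => [|||s /weight_gt0[/common_witness[]]//].
- exact: cvxW.
- exact: weight_ge0.
- exact: sum_weight_gt0.
Qed.

(** Every [s] of positive weight contains [v], so all the averaged points
    belong to the convex set [C v]. *)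
Lemma to_space_C v : c < w 0 (enum_rank v) -> C v (to_space w).
Proof.
move=> vc; apply: convex_wavg => [|||s /weight_gt0[/common_witness[_ Cs] sv]].
- exact: cvxC.
- exact: weight_ge0.
- exact: sum_weight_gt0.
- exact/Cs/sv.
Qed.

(** With [to_nerve_face] this puts [trim w] and [to_nerve (to_space w)] in a
    common simplex.  The point [w] itself need not share one with
    [to_nerve (to_space w)], which is why small coordinates are trimmed first. *)
Lemma trim_near : face (near_set (to_space w)) (trim w).
Proof. by apply: trim_in => v /to_space_C Cv; rewrite inE; apply/asboolP. Qed.

Lemma cont_trim : {for w, continuous trim}.
Proof.
apply: continuous_wavg => [v|]; last by rewrite gt_eqF// sum_excess_gt0.
apply: continuous_pos_part.
apply: continuous_subl.
exact: coord_continuous.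
Qed.

Lemma cont_to_space : {for w, continuous to_space}.
Proof.
apply: continuous_wavg => [s|]; last by rewrite gt_eqF// sum_weight_gt0.
apply: continuousM; apply: continuous_prod => v; first exact: coord_continuous.
apply: continuous_pos_part.
apply: continuous_subr.
exact: coord_continuous.
Qed.

End InRealization.

Lemma cont_to_nerve y : W y -> {for y, continuous to_nerve}.
Proof.
move=> Wy; apply: continuous_wavg => [v|]; last by rewrite gt_eqF// sum_u_gt0.
exact: u_cont.
Qed.

Definition clamp01 (t : R) : R := Num.max 0 (Num.min 1 t).

Lemma clamp01_itv t : 0 <= clamp01 t <= 1.
Proof.
by rewrite /clamp01 le_max lexx/= ge_max ler01 ge_min lexx.
Qed.

Lemma clamp01_le0 t : t <= 0 -> clamp01 t = 0.
Proof.
by move=> t0; rewrite /clamp01 min_r ?max_l// (le_trans t0).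
Qed.

Lemma clamp01_ge1 t : 1 <= t -> clamp01 t = 1.
Proof. by move=> t1; rewrite /clamp01 min_l// max_r. Qed.

Lemma cont_clamp01 : continuous clamp01.
Proof.
move=> t; apply: continuous_pos_part.
by apply: (@continuous_min R R (cst 1) id) => //; exact: cvg_cst.
Qed.

Definition stage (k : R) (tw : R * 'rV[R]_#|V|) : R := clamp01 (3 * tw.1 - k).

(** Three successive straight-line motions, on the thirds of the unit interval:
    [w] to [trim w], then to [to_nerve (to_space w)], then along the image of
    the segment from [to_space w] to [y0].  A stage is stationary outside its
    own third, which makes the formula continuous without gluing. *)
Definition homotopy (tw : R * 'rV[R]_#|V|) : 'rV[R]_#|V| :=
  lerp (stage 1 tw) (lerp (stage 0 tw) tw.2 (trim tw.2))
    (to_nerve (lerp (stage 2 tw) (to_space tw.2) y0)).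

(** Stage by stage, the simplices that contain the moving point are [supp w],
    then [near_set (to_space w)], then [near_set y] for [y] on the segment from
    [to_space w] to [y0]. *)
Theorem contractible_nerve : contractible_complex R K.
Proof.
have realN y : W y -> realization R K (to_nerve y).
  by move=> Wy; apply: (face_nerve (common_near Wy)); exact: to_nerve_face.
exists (to_nerve y0), homotopy; split.
- exact: realN.
- apply: continuous_in_subspaceT => -[t w]; rewrite inE => -[/= _ wK].
  have cstage k : {for (t, w), continuous (stage k)}.
    apply: (@continuous_comp _ _ _
      (fun tw : R * 'rV[R]_#|V| => 3 * tw.1 - k) clamp01).
      by apply/continuous_subl/continuous_scale; exact: cvg_fst.
    exact: cont_clamp01.
  have cw : {for (t, w), continuous (fun tw : R * 'rV[R]_#|V| => tw.2)}.
    exact: cvg_snd.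
  have ctrim : {for (t, w), continuous (trim \o snd)}.
    by apply: continuous_comp => //; exact: cont_trim.
  have cspace : {for (t, w), continuous (to_space \o snd)}.
    by apply: continuous_comp => //; exact: cont_to_space.
  have cseg : {for (t, w), continuous (fun tw : R * 'rV[R]_#|V| =>
      lerp (stage 2 tw) (to_space tw.2) y0)}.
    by apply: continuous_lerp => //; exact: cst_continuous.
  have cnerve : {for (t, w), continuous (fun tw : R * 'rV[R]_#|V| =>
      to_nerve (lerp (stage 2 tw) (to_space tw.2) y0))}.
    apply: continuous_comp cseg _; apply: cont_to_nerve; apply: cvxW => //.
      exact: to_space_W.
    exact: clamp01_itv.
  by apply: continuous_lerp => //; exact: continuous_lerp.
- move=> t w _ wK; rewrite /homotopy/=.
  have Wf := to_space_W wK.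
  have [t1|t1] := lerP (3 * t) 1.
    rewrite [stage 1 _]clamp01_le0 ?subr_le0// lerp0.
    have /KE[_ [y ys]] : supp w \in K by case: wK.
    apply: (face_nerve ys); apply: convex_face.
    + exact: realization_face.
    + exact: trim_supp.
    + exact: clamp01_itv.
  rewrite [stage 0 _]clamp01_ge1 ?subr0 ?(ltW t1)// lerp1.
  have [t2|t2] := lerP (3 * t) 2.
    rewrite [stage 2 _]clamp01_le0 ?subr_le0// lerp0.
    apply: (face_nerve (common_near Wf)); apply: convex_face.
    + exact: trim_near.
    + exact: to_nerve_face.
    + exact: clamp01_itv.
  rewrite [stage 1 _]clamp01_ge1/= ?lerp1; last lra.
  apply: realN; apply: cvxW => //.
  exact: clamp01_itv.
- move=> w wK; rewrite /homotopy/=; split.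
    by rewrite [stage 1 _]clamp01_le0/= ?lerp0 1?[stage 0 _]clamp01_le0/= ?lerp0//; lra.
  by rewrite [stage 1 _]clamp01_ge1/= ?lerp1 1?[stage 2 _]clamp01_ge1/= ?lerp1//; lra.
Qed.

End Nerve.

(** * The Euler-Poincare formula *)

Section EulerPoincare.
Variables (V : finType) (K : {set {set V}}).
Hypothesis K0 : finset.set0 \notin K.
Hypothesis K_down : forall s t : {set V},
  s \in K -> t \subset s -> t != finset.set0 -> t \in K.

(** There are two ways to add one element to [s] on the way to [t]; modulo two
    this is the vanishing of the boundary of a boundary. *)
Lemma card_between (s t : {set V}) : s \subset t -> #|t| = #|s|.+2 ->
  #|[set x : {set V} | [&& s \subset x, x \subset t & #|x| == #|s|.+1]]%SET| = 2%N.
Proof.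
move=> st cst.
have -> : [set x : {set V} | [&& s \subset x, x \subset t & #|x| == #|s|.+1]]%SET =
    [set v |: s | v in t :\: s]%SET.
  apply/setP => x; rewrite inE; apply/and3P/imsetP => [[sx xt /eqP cx]|[v]].
    have /cards1P[v vE] : #|x :\: s| == 1%N.
      by rewrite cardsD (finset.setIidPr sx) cx subSnn.
    have vx : v \in (x :\: s)%SET by rewrite vE inE.
    exists v.
      by move: vx; rewrite !inE => /andP[-> /=]; exact: (fintype.subsetP xt).
    by rewrite -vE finset.setUC -{1}(finset.setID x s) (finset.setIidPr sx).
  rewrite inE => /andP[vs vt] ->; split.
  - exact: finset.subsetUr.
  - by rewrite finset.subUset finset.sub1set vt.
  - by rewrite cardsU1 vs.
rewrite card_in_imset.
  by rewrite cardsD (finset.setIidPr st) cst -addn2 addKn.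
move=> v w; rewrite !inE => /andP[vs _] /andP[ws _] /setP /(_ v).
by rewrite !inE eqxx (negbTE vs) !orbF => /esym/eqP.
Qed.

Lemma boundary_boundary k : (boundary K k.+1 *m boundary K k = 0)%R.
Proof.
apply/matrixP => i j; rewrite !mxE.
under eq_bigr do rewrite !mxE -natrM mulnb.
rewrite -natr_sum; have := enum_valP i; have := enum_valP j.
move: (enum_val i) (enum_val j) => t s.
rewrite !inE => /andP[sK /eqP cs] /andP[tK /eqP ct].
pose F (x : {set V}) : nat := (x \subset t) && (s \subset x).
rewrite -(big_enum_val F) /F -big_mkcondr /= sum1_card.
have two0 : 2%:R = 0 :> 'F_2 by exact: val_inj.
have [st|nst] := boolP (s \subset t); last first.
  rewrite (_ : #|_| = 0%N)//; apply: eq_card0 => x; rewrite unfold_in.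
  apply: contraNF nst => /and3P[_ xt sx]; exact: fintype.subset_trans xt.
rewrite (_ : #|_| = 2%N)// -(card_between st); last by rewrite cs ct.
apply: eq_card => x; rewrite unfold_in !inE cs.
apply/and3P/and3P => [[/andP[_ cx] xt sx]|[sx xt cx]]; split=> //.
rewrite cx andbT (K_down tK)//; apply: contraTneq cx => ->.
by rewrite cards0.
Qed.

(** The ranks of the boundary maps telescope, leaving the last one.  That the
    boundary of a boundary vanishes ensures that the subtraction in [betti] is
    not truncated. *)
Lemma betti_alternating n :
  \sum_(k < n) (-1) ^+ k * (betti K k)%:Z =
  \sum_(k < n) (-1) ^+ k * #|simplices K k|%:Z +
  (if n is m.+1 then (-1) ^+ n * (dim_boundaries K m)%:Z else 0).
Proof.
elim: n => [|n IH]; first by rewrite !big_ord0 addr0.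
rewrite !big_ord_recr /= IH /betti.
case: n {IH} => [|n] /=.
  by rewrite -subzn ?rank_leq_col//; ring.
rewrite mxrank_ker -!subzn ?rank_leq_row//; first by rewrite !exprS; ring.
rewrite -mxrank_ker mxrankS//; apply/sub_kermxP; exact: boundary_boundary.
Qed.

Lemma euler_poincare :
  euler_characteristic K = \sum_(s in K) (-1) ^+ #|s|.-1.
Proof.
rewrite /euler_characteristic betti_alternating.
have -> : (if #|V| is m.+1 then
    (-1) ^+ #|V| * (dim_boundaries K m)%:Z else 0) = 0 :> int.
  (* A simplex of one more dimension would need more vertices than [V] has. *)
  case E : #|V| => [//|m].
  suff -> : dim_boundaries K m = 0%N by rewrite mulr0.
  apply/eqP; rewrite -leqn0 (leq_trans (rank_leq_row _))// leqn0 cards_eq0.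
  apply/eqP/setP => s; rewrite !inE; apply/negbTE/negP => /andP[_ /eqP cs].
  by have := max_card (mem s); rewrite cs E ltnn.
rewrite addr0.
transitivity (\sum_(k < #|V|) \sum_(s in K | #|s| == k.+1) (-1) ^+ k : int).
  apply: eq_bigr => k _.
  rewrite sumr_const -mulr_natr natz; congr (_ * Posz _).
  by apply: eq_card => s; rewrite !inE.
rewrite (exchange_big_dep (mem K)) /=; last by move=> k s _ /andP[].
apply: eq_bigr => s sK.
have s_gt0 : (0 < #|s|)%N by rewrite card_gt0; apply: contraNneq K0 => <-.
have sV : (#|s|.-1 < #|V|)%N by rewrite prednK// max_card.
rewrite (big_pred1 (Ordinal sV))// => k; rewrite sK/= -val_eqE/=.
by rewrite -(prednK s_gt0) eqSS eq_sym.
Qed.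

End EulerPoincare.

(** * The Euler characteristic as a valuation on compact convex sets *)

Section Valuation.
Variable (R : realType).

Lemma positive_lower_bound (I : finType) (f : I -> R) :
  exists2 e, 0 < e & forall i, 0 < f i -> e < f i.
Proof.
pose m := \big[Num.min/1]_(i | 0 < f i) f i.
have m0 : 0 < m by apply: lt_bigmin.
exists (m / 2); first by rewrite divr_gt0.
move=> i fi; have : m <= f i by exact: bigmin_le_cond.
by move=> mf; lra.
Qed.

(** Compare the relation at [t] and just to the right of [t]: the two sums
    differ exactly by the intervals that end at [t], so the coefficients of
    those intervals add up to zero for each [t]. *)
Lemma euler_intervals (I : finType) (D : pred I) (a : I -> int) (l u : I -> R) :
  (forall i, D i -> l i <= u i) ->
  (forall t, \sum_(i | D i && (l i <= t <= u i)) a i = 0) ->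
  \sum_(i | D i) a i = 0.
Proof.
move=> lu F0.
have G0 t : \sum_(i | D i && (u i == t)) a i = 0.
  have [e1 e1_gt0 He1] := positive_lower_bound (fun i => l i - t).
  have [e2 e2_gt0 He2] := positive_lower_bound (fun i => u i - t).
  have [e [e_gt0 ee1 ee2]] : exists e, [/\ 0 < e, e <= e1 & e <= e2].
    exists (Num.min e1 e2).
    by rewrite lt_min e1_gt0 e2_gt0 !ge_min !lexx orbT.
  have := F0 t; rewrite (bigID (fun i => u i == t))/= => /eqP.
  rewrite (_ : \sum_(i | _ && (u i != t)) a i = 0) ?addr0; last first.
    rewrite -[RHS](F0 (t + e)); apply: eq_bigl => i.
    have [Di|//] := boolP (D i); have := lu _ Di; rewrite /=.
    have := He1 i; have := He2 i; rewrite !subr_gt0 => h2 h1 lui.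
    have [<-|ut] := eqVneq (u i) t.
      rewrite andbF; apply/esym/negbTE; rewrite negb_and -!ltNge.
      by apply/orP; right; lra.
    rewrite andbT; move: ut; rewrite neq_lt => /orP[ut|ut].
      have -> : (t <= u i) = false by rewrite leNgt ut.
      have -> : (t + e <= u i) = false by apply/negbTE; rewrite -ltNge; lra.
      by rewrite !andbF.
    have := h2 ut => {}h2.
    have -> : t <= u i by lra.
    have -> : t + e <= u i by lra.
    rewrite !andbT; have [lt|tl] := lerP (l i) t.
      by apply/esym; lra.
    by have := h1 tl => {}h1; apply/esym/negbTE; rewrite -ltNge; lra.
  move=> /eqP u0; rewrite -[RHS]u0; apply: eq_bigl => i.
  have [Di|//] := boolP (D i); have := lu _ Di; rewrite /=.
  by have [->|ut] := eqVneq (u i) t; rewrite ?andbF// lexx !andbT => ->.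
pose s := undup [seq u i | i : I].
have us i : [seq t <- s | t == u i] = [:: u i].
  apply: filter_pred1_uniq; first exact: undup_uniq.
  by rewrite mem_undup; apply: map_f; rewrite mem_enum.
transitivity (\sum_(i | D i) \sum_(t <- s | t == u i) a i).
  by apply: eq_bigr => i _; rewrite -big_filter us big_seq1.
rewrite (exchange_big_dep predT)//= big1_seq// => t _.
by rewrite -[RHS](G0 t); apply: eq_bigl => i; rewrite eq_sym.
Qed.

(** Hadwiger's induction.  The sets lie in an affine subspace where the
    coordinates from [k] on are frozen.  The induction hypothesis applied to
    the slices at height [t] of one further coordinate says that the
    projections to that coordinate, which are compact intervals, satisfy the
    same relation; [euler_intervals] concludes. *)
Lemma valuation_slices (d k : nat) (I : finType) (a : I -> int)
    (A : I -> set 'rV[R]_d) (z : 'rV[R]_d) :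
  (forall i, compact (A i)) -> (forall i, convex (A i)) ->
  (forall i x, A i x -> forall j : 'I_d, (k <= j)%N -> x 0 j = z 0 j) ->
  (forall x, \sum_(i | `[< A i x >]) a i = 0) ->
  \sum_(i | `[< A i !=set0 >]) a i = 0.
Proof.
elim: k A z => [|k IH] A z cpA cvA Az A0.
  rewrite -[RHS](A0 z). apply: eq_bigl => i; apply/asboolP/asboolP => [[x Ax]|Ax].
    suff -> : z = x by [].
    by apply/rowP => j; rewrite (Az _ _ Ax).
  by exists z.
have [kd|dk] := ltnP k d; last first.
  apply: (IH A z) => // i x Ax j kj.
  by have := ltn_ord j; rewrite ltnNge (leq_trans dk).
pose j0 := Ordinal kd.
have cj A' : {within A', continuous (fun x : 'rV[R]_d => x 0 j0)}.
  by apply: continuous_subspaceT; exact: coord_continuous.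
have F0 t : \sum_(i | `[< A i `&` [set x | x 0 j0 = t] !=set0 >]) a i = 0.
  apply: (IH _ (\row_j (if j == j0 then t else z 0 j))).
  - move=> i; apply: (subclosed_compact _ (cpA i)) => [|x []//].
    apply: closedI; first exact: compact_closed.
    apply: (@closed_comp _ _ (fun x : 'rV[R]_d => x 0 j0) [set t]).
      by move=> x _; exact: coord_continuous.
    exact: closed_eq.
  - move=> i; apply: convexI => // x y s /= xt yt _.
    by rewrite /lerp !mxE xt yt; ring.
  - move=> i x [Ax /= xt] j kj; rewrite mxE; case: eqP => [->//|/eqP jj0].
    by apply: (Az i) => //; rewrite ltn_neqAle kj andbT eq_sym.
  - move=> x; have [xt|xt] := eqVneq (x 0 j0) t.
      rewrite -[RHS](A0 x); apply: eq_bigl => i.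
      by apply/asboolP/asboolP => [[]|].
    rewrite big_pred0// => i; apply/asboolP => -[_ /= xt'].
    by rewrite xt' eqxx in xt.
have Imin i : A i !=set0 -> exists2 c, A i c & forall x, A i x -> c 0 j0 <= x 0 j0.
  move=> Ai; have [c /set_mem Ac cm] := compact_EVT_min Ai (cpA i) (cj (A i)).
  by exists c => // x Ax; apply/cm/mem_set.
have Imax i : A i !=set0 -> exists2 c, A i c & forall x, A i x -> x 0 j0 <= c 0 j0.
  move=> Ai; have [c /set_mem Ac cm] := compact_EVT_max Ai (cpA i) (cj (A i)).
  by exists c => // x Ax; apply/cm/mem_set.
have lu i : exists lu : R * R, A i !=set0 -> lu.1 <= lu.2 /\
    forall t, A i `&` [set x | x 0 j0 = t] !=set0 <-> lu.1 <= t <= lu.2.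
  have [Ai|Ai] := pselect (A i !=set0); last by exists (0, 0).
  have [c Ac cm] := Imin i Ai; have [c' Ac' cm'] := Imax i Ai.
  exists (c 0 j0, c' 0 j0) => _ /=; split; first exact: cm.
  move=> t; split=> [[x [Ax /= <-]]|/andP[ct tc']].
    by rewrite cm ?cm'.
  have [cc'|cc'] := eqVneq (c 0 j0) (c' 0 j0).
    by exists c; split=> //=; apply/eqP; rewrite eq_le ct cc'.
  have {}cc' : 0 < c' 0 j0 - c 0 j0 by rewrite subr_gt0 lt_neqAle cc' cm.
  (* The height is affine along the segment from a lowest to a highest point. *)
  exists (lerp ((t - c 0 j0) / (c' 0 j0 - c 0 j0)) c c'); split.
    apply: cvA => //; rewrite divr_ge0 ?subr_ge0 ?(ltW cc')//=; last first.
      by rewrite -subr_ge0 ltW.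
    by rewrite ler_pdivrMr// mul1r lerB.
  by rewrite /= /lerp !mxE; field; rewrite gt_eqF.
have [f fP] := choice lu.
apply: (@euler_intervals _ _ _ (fun i => (f i).1) (fun i => (f i).2)).
  by move=> i /asboolP /fP[].
move=> t; rewrite -[RHS](F0 t); apply: eq_bigl => i.
have [/[dup] Ai /asboolP -> /=|Ai] := pselect (A i !=set0).
  by have [_ /(_ t) [h1 h2]] := fP i Ai; apply/idP/asboolP.
rewrite asboolF//=; apply/esym/asboolP => -[x [Ax _]].
by apply: Ai; exists x.
Qed.

Lemma euler_valuation (d : nat) (I : finType) (a : I -> int)
    (A : I -> set 'rV[R]_d) :
  (forall i, compact (A i)) -> (forall i, convex (A i)) ->
  (forall x, \sum_(i | `[< A i x >]) a i = 0) ->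
  \sum_(i | `[< A i !=set0 >]) a i = 0.
Proof.
move=> cpA cvA; apply: (@valuation_slices d d _ _ _ 0) => // i x _ j.
by rewrite leqNgt ltn_ord.
Qed.

End Valuation.

(** Expand the product over [v] of [1 - (v \in J)], which has a zero factor. *)
Lemma alternating_subsets (V : finType) (J : {set V}) : J != finset.set0 ->
  \sum_(s : {set V} | s \subset J) (-1) ^+ #|s| = 0 :> int.
Proof.
move=> /set0Pn[v vJ].
transitivity (\prod_v ((if v \in J then -1 else 0) + 1) : int); last first.
  by rewrite (bigD1 v)//= vJ addNr mul0r.
rewrite bigA_distr [RHS](bigID (fun s : {set V} => s \subset J))/=.
rewrite [X in _ = _ + X]big1 ?addr0.
  apply: eq_bigr => s sJ; rewrite -prodr_const big_mkcond/=.
  apply: eq_bigr => w _; case: ifPn => // ws.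
  by rewrite (fintype.subsetP sJ).
move=> s /fintype.subsetPn[w ws wJ].
by rewrite (bigD1 w)//= ws (negbTE wJ) mul0r.
Qed.

(** Apply [euler_valuation] to the family of all intersections, including the
    empty one, which is [W] itself and contributes the constant [1]. *)
Lemma euler_nerve (R : realType) (d : nat) (V : finType) (W : set 'rV[R]_d)
    (C : V -> set 'rV[R]_d) (K : {set {set V}}) :
  (forall s, reflect (s != finset.set0 /\ exists y, common_point W C s y) (s \in K)) ->
  convex W -> compact W -> W !=set0 ->
  (forall v, convex (C v)) -> (forall v, closed (C v)) ->
  (forall y, W y -> exists v, C v y) ->
  euler_characteristic K = 1.
Proof.
move=> KE cvW cpW [y0 Wy0] cvC clC WC.
have K0 : finset.set0 \notin K by apply/KE; rewrite eqxx => -[].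
have common_sub (s t : {set V}) y :
    common_point W C s y -> t \subset s -> common_point W C t y.
  by move=> [Wy Cy] ts; split=> // v vt; apply: Cy; exact: (fintype.subsetP ts).
rewrite euler_poincare//; last first.
  move=> s t /KE[_ [y sy]] ts t0; apply/KE; split=> //.
  by exists y; exact: common_sub sy ts.
have : \sum_(s : {set V} | `[< common_point W C s !=set0 >]) (-1) ^+ #|s| = 0 :> int.
  apply: euler_valuation => [s|s|x].
  - have -> : common_point W C s = W `&` \bigcap_(v in [set` s]) C v by [].
    apply: (subclosed_compact _ cpW) => [|x []//].
    apply: closedI; first exact: compact_closed.
    exact: closed_bigI.
  - by move=> x y t [Wx Cx] [Wy Cy] t01; split=> [|v vs]; [exact: cvW|apply: cvC; auto].
  have [Wx|Wx] := pselect (W x); last first.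
    by rewrite big_pred0// => s; apply/asboolP => -[].
  rewrite -[RHS](@alternating_subsets _ (near_set C x)).
    apply: eq_bigl => s; apply/asboolP/fintype.subsetP => [[_ Cx] v /Cx|sC].
      by rewrite inE => ?; apply/asboolP.
    by split=> // v /sC; rewrite inE => /asboolP.
  have [v Cv] := WC _ Wx; apply/set0Pn; exists v; rewrite inE.
  exact/asboolP.
rewrite (bigD1 finset.set0)/=; last first.
  by apply/asboolP; exists y0; split=> // v; rewrite inE.
rewrite cards0 expr0 => /eqP; rewrite addrC addr_eq0 => /eqP E.
rewrite -[RHS]opprK -[X in _ = - X]E -sumrN; apply: eq_big => s.
  apply/KE/andP => [[s0 [y sy]]|[/asboolP[y sy] s0]]; split=> //.
    by apply/asboolP; exists y.
  by exists y.
move=> /KE[s0 _]; rewrite -[in RHS](prednK (n := #|s|)) ?card_gt0//.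
by rewrite exprS mulN1r opprK.
Qed.

(** * Cech complexes of dense subsets of a cube *)

Lemma continuous_translate (R : realType) (E : normedModType R) (c : E) :
  continuous (fun y => y - c).
Proof. by move=> y; apply: cvgB => //; exact: cvg_cst. Qed.

Section Balls.
Variables (R : realType) (d : nat).
Implicit Types (x y c : 'rV[R]_d) (r h : R).

Lemma enorm_ge0 x : 0 <= enorm x.
Proof. exact: sqrtr_ge0. Qed.

Lemma enorm_le x r : 0 <= r -> (enorm x <= r) = (\sum_(i < d) x 0 i ^+ 2 <= r ^+ 2).
Proof.
move=> r0; have S0 : 0 <= \sum_(i < d) x 0 i ^+ 2.
  by apply: sumr_ge0 => i _; exact: sqr_ge0.
by rewrite -[in LHS](ger0_norm r0) -sqrtr_sqr ler_sqrt// sqr_ge0.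
Qed.

Lemma enorm_le_coord x y :
  (forall i, `|x 0 i| <= `|y 0 i|) -> enorm x <= enorm y.
Proof.
move=> xy; rewrite /enorm ler_wsqrtr// ler_sum// => i _.
by rewrite -real_normK ?num_real// -[leRHS]real_normK ?num_real// lerXn2r ?nnegrE.
Qed.

Lemma enorm_le_sup x r : 0 <= r -> (forall i, `|x 0 i| <= r) ->
  enorm x <= d%:R * r.
Proof.
move=> r0 xr; rewrite enorm_le ?mulr_ge0//.
apply: (@le_trans _ _ (\sum_(i < d) r ^+ 2)).
  apply: ler_sum => i _.
  by rewrite -real_normK ?num_real// lerXn2r ?nnegrE.
rewrite sumr_const card_ord exprMn -[_ *+ d]mulr_natl ler_wpM2r ?sqr_ge0//.
by rewrite -natrX ler_nat; case: d => // n; rewrite leq_pmulr.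
Qed.

Lemma continuous_enorm : continuous (@enorm R d).
Proof.
have sq i : continuous (fun x : 'rV[R]_d => x 0 i ^+ 2).
  have ci : continuous (fun x : 'rV[R]_d => x 0 i) by exact: coord_continuous.
  move=> x; apply: (continuous_comp (g := fun t : R => t ^+ 2) (ci x)).
  exact: exprn_continuous.
have cS := continuous_big (@add_continuous R) (fun i _ => sq i).
move=> x; apply: (continuous_comp (g := Num.sqrt) (cS 0 xpredT _ x)).
exact: sqrt_continuous.
Qed.

Lemma continuous_dist c : continuous (fun y => enorm (y - c)).
Proof.
move=> y; apply: (continuous_comp (@continuous_translate _ _ c y)).
exact: continuous_enorm.
Qed.

(** Convexity of the square in each coordinate suffices, without Minkowski's
    inequality. *)
Lemma convex_eball c r : convex (eball c r).
Proof.
move=> x y t; rewrite /eball/=.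
have [r0 xr yr /andP[t0 t1]|r0 xr] := lerP 0 r; last first.
  by have := le_trans (enorm_ge0 _) xr; rewrite leNgt r0.
move: xr yr; rewrite !enorm_le// => xr yr.
pose q z := \sum_(i < d) (z - c) 0 i ^+ 2.
apply: (@le_trans _ _ ((1 - t) * q x + t * q y)).
  rewrite /q !mulr_sumr -big_split/= ler_sum// => i _; rewrite !mxE.
  have : 0 <= t * (1 - t) * (x 0 i - y 0 i) ^+ 2.
    by rewrite mulr_ge0 ?sqr_ge0// mulr_ge0// subr_ge0.
  lra.
apply: (@le_trans _ _ ((1 - t) * r ^+ 2 + t * r ^+ 2)); last by lra.
by rewrite lerD// ler_wpM2l// subr_ge0.
Qed.

Lemma closed_eball c r : closed (eball c r).
Proof.
apply: (@closed_comp _ _ (fun y => enorm (y - c)) [set t | t <= r]).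
  by move=> x _; exact: continuous_dist.
exact: closed_le.
Qed.

Definition cube h : set 'rV[R]_d := [set x | forall i, `|x 0 i| <= h].

Lemma convex_cube h : convex (cube h).
Proof.
move=> x y t xh yh /andP[t0 t1] i; rewrite /lerp !mxE.
rewrite (le_trans (ler_normD _ _))// !normrM (ger0_norm t0) ger0_norm ?subr_ge0//.
apply: (@le_trans _ _ ((1 - t) * h + t * h)); last by lra.
by rewrite lerD// ler_wpM2l// subr_ge0.
Qed.

Lemma compact_cube h : compact (cube h).
Proof.
have -> : cube h = [set v : 'rV[R]_d | forall i, `[(- h), h]%classic (v ord0 i)].
  by apply/seteqP; split=> x xh i; have := xh i; rewrite /= in_itv/= ler_norml.
by apply: (@rV_compact _ _ (fun=> `[(- h), h]%classic)) => i; exact: segment_compact.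
Qed.

Definition clip h y : 'rV[R]_d := \row_i Num.max (- h) (Num.min h (y 0 i)).

Lemma clip_cube h y : 0 <= h -> cube h (clip h y).
Proof.
move=> h0 i; rewrite mxE ler_norml le_max lexx/= ge_max ge_min lexx/= andbT.
lra.
Qed.

(** Clipping is the projection onto the cube, so it moves points towards every
    point of the cube.  Thus balls centred in the cube that meet at all already
    meet inside the cube. *)
Lemma clip_eball h c r y : cube h c -> eball c r y -> eball c r (clip h y).
Proof.
move=> ch; rewrite /eball/=; apply: le_trans; apply: enorm_le_coord => i.
rewrite !mxE; have := ch i; rewrite ler_norml => /andP[c1 c2].
have n1 := ler_norm (y 0 i - c 0 i).
have := ler_norm (c 0 i - y 0 i); rewrite distrC => n2.
rewrite minEle maxEle ler_norml.
by case: (lerP h (y 0 i)) => hy; case: (lerP (- h) _) => hy'; apply/andP; split; lra.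
Qed.

(** Strict inequality in the density hypothesis makes the functions
    [eps / 2 - enorm (y - a)], cut off at zero, a partition of unity up to
    normalization while the nerve is formed with closed balls. *)
Theorem cech_dense (A : {fset 'rV[R]_d}) (h eps : R) : 0 <= h ->
  (forall a, a \in A -> cube h a) ->
  (forall x, cube h x -> exists2 a, a \in A & enorm (x - a) < eps / 2) ->
  contractible_complex R (cech A eps) /\ euler_characteristic (cech A eps) = 1.
Proof.
move=> h0 Ah dense.
pose C (v : A) := eball (val v) (eps / 2).
have KE s : reflect (s != finset.set0 /\ exists y, common_point (cube h) C s y)
    (s \in cech A eps).
  rewrite inE; apply: (iffP andP) => -[-> ]; [move=> /asboolP|] => -[y Cy]; split=> //.
    exists (clip h y); split=> [|v vs]; first exact: clip_cube.
    by apply: clip_eball; [exact: Ah (valP v)|exact: Cy].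
  by apply/asboolP; exists y; case: Cy.
split.
  apply: (@contractible_nerve _ _ _ (cube h) C
    (fun v y => Num.max 0 (eps / 2 - enorm (y - val v)))) KE _ _ _ _ (0 : 'rV[R]_d) _.
  - exact: convex_cube.
  - by move=> v; exact: convex_eball.
  - move=> v y _; apply: continuous_pos_part; apply: continuous_subr.
    exact: continuous_dist.
  - by move=> v y; rewrite le_max lexx.
  - by move=> v y; rewrite lt_max ltxx/= subr_gt0 => /ltW.
  - move=> y /dense[a aA ya]; exists [` aA]%fset.
    by rewrite lt_max subr_gt0/= ya orbT.
  - by move=> i; rewrite mxE normr0.
apply: (@euler_nerve _ _ _ (cube h) C) KE _ _ _ _ _ _.
- exact: convex_cube.
- exact: compact_cube.
- by exists 0 => i; rewrite mxE normr0.
- by move=> v; exact: convex_eball.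
- by move=> v; exact: closed_eball.
- move=> y /dense[a aA /ltW ya]; exists [` aA]%fset.
  exact: ya.
Qed.

End Balls.

(** * Grids of cells and their volumes *)

Section Cells.
Variable R : realType.

Definition cell (d : nat) (a : 'I_d -> R) (s : R) : set 'rV[R]_d :=
  [set x | forall i, a i <= x 0 i <= a i + s].

Lemma volume0 d : volume (set0 : set 'rV[R]_d) = 0%E.
Proof.
elim: d => [|d IH] /=; first by rewrite indic0.
by rewrite -[RHS](integral0 lebesgue_measure setT); apply: eq_integral => t _; exact: IH.
Qed.

Lemma cell_slice d (a : 'I_d.+1 -> R) s (t : R) :
  [set v : 'rV[R]_d | cell a s (row_mx (t%:M : 'rV[R]_1) v)] =
  if a ord0 <= t <= a ord0 + s then cell (fun i => a (lift ord0 i)) s else set0.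
Proof.
have r0 (v : 'rV[R]_d) : (row_mx (t%:M : 'rV[R]_1) v : 'rV[R]_d.+1) 0 ord0 = t.
  by rewrite mxE; case: splitP => // j _; rewrite ord1 mxE.
have rS (v : 'rV[R]_d) i :
    (row_mx (t%:M : 'rV[R]_1) v : 'rV[R]_d.+1) 0 (lift ord0 i) = v 0 i.
  rewrite mxE; case: splitP => [j|j [/val_inj ->]//].
  by rewrite ord1.
case: ifPn => at_.
  apply/seteqP; split=> v /= vc i; first by have := vc (lift ord0 i); rewrite rS.
  by have [j ->|->] := unliftP ord0 i; [rewrite rS|rewrite r0].
by apply/seteqP; split=> v //= vc; have := vc ord0; rewrite r0 (negbTE at_).
Qed.

Lemma volume_cell d (a : 'I_d -> R) s : 0 <= s ->
  volume (cell a s) = (s ^+ d)%:E.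
Proof.
move=> s0; elim: d a => [|d IH] a /=.
  by rewrite expr0 indicE mem_set// => -[].
pose I : set R := `[a ord0, a ord0 + s]%classic.
transitivity (\int[lebesgue_measure]_(t in I) (cst (s ^+ d)%:E t))%E.
  rewrite [RHS]integral_mkcond; apply: eq_integral => t _.
  rewrite cell_slice patchE mem_setE in_itv /=.
  by case: ifP => _; rewrite ?IH ?volume0.
transitivity ((s ^+ d)%:E * lebesgue_measure I)%E.
  by apply: integral_cst; exact: measurable_itv.
rewrite lebesgue_measure_itv/= lte_fin ltrDl -EFinD.
rewrite [in RHS]exprSr EFinM; congr (_ * _)%E.
move: s0; rewrite le_eqVlt => /orP[/eqP <-|s0]; first by rewrite ltxx.
by rewrite s0 addrAC subrr add0r.
Qed.

Lemma compact_cell d (a : 'I_d -> R) s : compact (cell a s).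
Proof.
have -> : cell a s =
    [set v : 'rV[R]_d | forall i, `[a i, a i + s]%classic (v ord0 i)].
  by apply/seteqP; split=> x xs i; have := xs i; rewrite /= in_itv.
apply: (@rV_compact _ _ (fun i => `[a i, a i + s]%classic)) => i.
exact: segment_compact.
Qed.

Lemma borel_closed d (B : set 'rV[R]_d) : closed B -> borel B.
Proof.
move=> cB; rewrite -(setCK B) -setTD; apply: sigma_algebraCD.
by apply: sub_sigma_algebra; exact: closed_openC.
Qed.

Lemma bounded_borel_cell d (a : 'I_d -> R) s : bounded_borel (cell a s).
Proof.
split; last exact/compact_bounded/compact_cell.
by apply: borel_closed; apply: compact_closed => //; exact: compact_cell.
Qed.

Lemma grid1 (m : nat) (s y : R) : (0 < m)%N -> 0 <= y <= m%:R * s ->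
  exists k : 'I_m, k%:R * s <= y <= k%:R * s + s.
Proof.
elim: m => // -[|m] IH _ /andP[y0 ym].
  by exists ord0; rewrite mul0r y0 add0r -[s]mul1r.
have [yl|ly] := lerP y (m.+1%:R * s).
  have [//||k kP] := IH _; first by rewrite y0 yl.
  by exists (widen_ord (leqnSn _) k).
exists ord_max; rewrite (ltW ly)/= (le_trans ym)// -[m.+2]addn1 natrD mulrDl.
by rewrite mul1r.
Qed.

(** The lowest corner of the cell with multi-index [k] in the grid of mesh [s]
    that starts at the corner of [cube h]. *)
Definition corner (d m : nat) (h s : R) (k : {ffun 'I_d -> 'I_m}) (i : 'I_d) : R :=
  - h + (k i)%:R * s.

Lemma grid_cover (d m : nat) (h s : R) (x : 'rV[R]_d) : (0 < m)%N ->
  m%:R * s = 2 * h -> cube h x -> exists k : {ffun 'I_d -> 'I_m}, cell (corner h s k) s x.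
Proof.
move=> m0 ms xh.
have H i : exists k : 'I_m, k%:R * s <= x 0 i + h <= k%:R * s + s.
  apply: grid1 => //; rewrite ms; have := xh i; rewrite ler_norml.
  by move=> /andP[? ?]; apply/andP; split; lra.
have [k kP] := choice H; exists [ffun i => k i] => i.
rewrite /corner ffunE; have /andP[? ?] := kP i.
by apply/andP; split; lra.
Qed.

Lemma grid_in (d m : nat) (h s : R) (k : {ffun 'I_d -> 'I_m}) :
  0 <= s -> m%:R * s = 2 * h -> cell (corner h s k) s `<=` cube h.
Proof.
move=> s0 ms x xk i; have /andP[x1 x2] := xk i; move: x1 x2; rewrite /corner => x1 x2.
have km : (k i)%:R * s + s <= m%:R * s.
  by rewrite -[X in _ + X]mul1r -mulrDl ler_wpM2r// natr1 ler_nat.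
have k0 : 0 <= (k i)%:R * s by rewrite mulr_ge0.
by rewrite ler_norml; apply/andP; split; lra.
Qed.

Lemma cell_diam (d : nat) (a : 'I_d -> R) s x y : 0 <= s ->
  cell a s x -> cell a s y -> enorm (x - y) <= d%:R * s.
Proof.
move=> s0 xa ya; apply: enorm_le_sup => // i; rewrite !mxE.
have /andP[? ?] := xa i; have /andP[? ?] := ya i.
by rewrite ler_norml; apply/andP; split; lra.
Qed.

End Cells.

(** * Choice of the mesh *)

Section Grid.
Variable R : realType.

Lemma two_ln_le (x : R) : 0 < x -> 2 * ln x <= x.
Proof.
move=> x0; have l2 : ln 2 <= 1 :> R.
  by have := @le_ln1Dx R 1; rewrite -[1 + 1]/(2 : R); apply; lra.
have lx : ln (x / 2) <= x / 2 - 1.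
  by have := @le_ln1Dx R (x / 2 - 1); rewrite [1 + _]addrC subrK; apply; lra.
have -> : ln x = ln (x / 2) + ln 2.
  by rewrite -lnM ?posrE ?divr_gt0// divfK.
lra.
Qed.

Lemma root_expn (d : nat) (x : R) : (0 < d)%N -> 0 <= x ->
  (x `^ d%:R^-1) ^+ d = x.
Proof.
move=> d0 x0; rewrite -powR_mulrn ?powR_ge0// -powRrM mulVf ?powRr1//.
by rewrite pnatr_eq0 -lt0n.
Qed.

(** Take for [m] the integer part of [L / S], where [L] is the side of the window
    and [S ^+ d = 2 * ln n].  The mesh [L / m] then lies between [S] and
    [2 * S]; the lower bound controls the void probabilities and the upper one
    the diameter of the cells. *)
Lemma grid_size (d n : nat) : (0 < d)%N -> 1 <= ln n%:R :> R ->
  exists (m : nat) (s : R), [/\ (0 < m)%N, 0 <= s,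
    m%:R * s = n%:R `^ d%:R^-1 /\ s <= 4 * ln n%:R `^ d%:R^-1 &
    (m ^ d)%:R * expR (- s ^+ d) <= n%:R^-1].
Proof.
move=> d0 ln1.
have n0 : 0 < n%:R :> R.
  by rewrite ltNge; apply/negP => /ln0 ln0; move: ln1; rewrite ln0 ler10.
have d1 : d%:R^-1 <= 1 :> R by rewrite invf_le1 ?ler1n ?ltr0n.
have dV : 0 <= d%:R^-1 :> R by rewrite invr_ge0.
pose L : R := n%:R `^ d%:R^-1; pose S : R := (2 * ln n%:R) `^ d%:R^-1.
have S0 : 0 < S by apply: powR_gt0; lra.
have L0 : 0 < L by exact: powR_gt0.
have SL : S <= L.
  by apply: ge0_ler_powR => //; rewrite ?nnegrE ?(ltW n0)//; [lra|exact: two_ln_le].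
have LS1 : 1 <= L / S by rewrite ler_pdivlMr// mul1r.
have /andP[mL Lm] := truncn_itv (le_trans ler01 LS1).
set m := Num.trunc (L / S) in mL Lm.
have m0 : (0 < m)%N by rewrite truncn_gt0.
have m0R : 0 < m%:R :> R by rewrite ltr0n.
have m1R : 1 <= m%:R :> R by rewrite ler1n.
exists m, (L / m%:R); split=> //.
- by rewrite divr_ge0 ?(ltW L0).
- split; first by rewrite mulrC divfK// gt_eqF.
  have SS : S <= 2 * ln n%:R `^ d%:R^-1.
    rewrite /S powRM//; last lra.
    rewrite ler_wpM2r ?powR_ge0// -[leRHS]powRr1//.
    by apply: ler_powR => //; lra.
  rewrite ler_pdivrMr//.
  have := Lm; rewrite ltr_pdivrMr// -natr1 => {}Lm.
  apply: (le_trans (ltW Lm)).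
  have : S * (m%:R + 1) <= S * (2 * m%:R) by rewrite ler_wpM2l ?(ltW S0)//; lra.
  have : S * (2 * m%:R) <= 2 * ln n%:R `^ d%:R^-1 * (2 * m%:R).
    by rewrite ler_wpM2r//; lra.
  lra.
have Sd : S ^+ d = 2 * ln n%:R by apply: root_expn => //; lra.
have Ld : L ^+ d = n%:R by apply: root_expn.
have mSL : m%:R * S <= L by rewrite -ler_pdivlMr.
have md : m%:R ^+ d <= n%:R :> R.
  have : (m%:R * S) ^+ d <= L ^+ d.
    by apply: lerXn2r; rewrite ?nnegrE ?(ltW L0) ?mulr_ge0 ?(ltW S0).
  rewrite exprMn Sd Ld; apply: le_trans; rewrite ler_peMr ?exprn_ge0//; lra.
have sd : 2 * ln n%:R <= (L / m%:R) ^+ d.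
  by rewrite -Sd lerXn2r ?nnegrE ?divr_ge0 ?(ltW S0) ?(ltW L0)// ler_pdivlMr// mulrC.
rewrite natrX; apply: (@le_trans _ _ (n%:R * expR (- (2 * ln n%:R)))).
  by apply: ler_pM; rewrite ?exprn_ge0 ?expR_ge0// ler_expR lerN2.
rewrite expRN expRM_natl lnK ?posrE// expr2 invfM mulrA divff ?mul1r//.
by rewrite gt_eqF.
Qed.

End Grid.

(** * Void probabilities and the union bound *)

Section Voids.
Context (R : realType) (d : nat) (disp : measure_display)
  (Omega : measurableType disp) (P : probability Omega R)
  (Phi : point_process R d Omega).

Definition void_event (B : set 'rV[R]_d) : set Omega :=
  [set omega | count_in Phi B omega = 0%E].

Lemma measurable_void_event B : bounded_borel B -> measurable (void_event B).
Proof.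
move=> bB.
pose E : set (configuration R d) := [set phi | counting (phi `&` B) = 0%:R%:E :> \bar R].
have mE : measurable E by apply: sub_sigma_algebra; exists B, 0%N.
by have := @measurable_funPT _ _ _ _ (points Phi) measurableT E mE; rewrite setTI.
Qed.

Lemma not_void_event B omega : ~ void_event B omega ->
  exists2 x, (Phi omega : set 'rV[R]_d) x & B x.
Proof.
move=> nv; apply: contrapT => nex; apply: nv; rewrite /void_event/= /count_in.
rewrite (_ : _ `&` _ = set0); last first.
  by apply/seteqP; split=> x //= [px bx]; apply: nex; exists x.
by rewrite /counting asboolT// fset_set0.
Qed.

Lemma union_bound (I : finType) (V : I -> set Omega) :
  (forall i, measurable (V i)) ->
  measurable [set omega | exists i, V i omega] /\
  (P [set omega | exists i, V i omega] <= \sum_i P (V i))%E.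
Proof.
move=> mV.
suff H (s : seq I) : measurable [set omega | exists2 i, i \in s & V i omega] /\
    (P [set omega | exists2 i, i \in s & V i omega] <= \sum_(i <- s) P (V i))%E.
  have -> // : [set omega | exists i, V i omega] =
      [set omega | exists2 i, i \in index_enum I & V i omega].
    by apply/seteqP; split=> omega /= [i]; [move=> Vi|move=> _ Vi];
      exists i; rewrite ?mem_index_enum.
elim: s => [|i s [mU PU]].
  rewrite (_ : [set omega | _] = set0) ?measure0 ?big_nil//.
  by apply/seteqP; split=> omega //= [].
have -> : [set omega | exists2 j, j \in i :: s & V j omega] =
    V i `|` [set omega | exists2 j, j \in s & V j omega].
  apply/seteqP; split=> omega /=.
    by move=> [j]; rewrite inE => /orP[/eqP ->|js Vj]; [left|right; exists j].
  move=> [Vi|[j js Vj]]; first by exists i; rewrite ?mem_head.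
  by exists j => //; rewrite inE js orbT.
split; first exact: measurableU.
by rewrite big_cons (le_trans (measureU2 P _ _))// leeD2l.
Qed.

End Voids.

(** * Contractibility with high probability *)

Section HighProbability.
Context (R : realType) (d : nat) (disp : measure_display)
  (Omega : measurableType disp) (P : probability Omega R)
  (Phi : point_process R d Omega).
Hypothesis d_gt0 : (0 < d)%N.

Lemma no_void_contractible (m n : nat) (s eps : R) omega :
  (0 < m)%N -> 0 <= s -> m%:R * s = n%:R `^ d%:R^-1 -> d%:R * s < eps / 2 ->
  (forall k : {ffun 'I_d -> 'I_m},
    ~ void_event Phi (cell (corner (n%:R `^ d%:R^-1 / 2) s k) s) omega) ->
  contractible_complex R (cech (window_points Phi n omega) eps) /\
  euler_characteristic (cech (window_points Phi n omega) eps) = 1.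
Proof.
set h := n%:R `^ _ / 2 => m0 s0 ms ds novoid.
have {}ms : m%:R * s = 2 * h by rewrite /h; lra.
have h0 : 0 <= h by rewrite divr_ge0 ?powR_ge0.
have finW : finite_set ((Phi omega : set 'rV[R]_d) `&` window n).
  by apply: points_locally_finite; apply: compact_bounded; exact: (@compact_cube R d h).
apply: (cech_dense h0) => [a|x /(grid_cover m0 ms)[k xk]].
  by rewrite in_fset_set// => /set_mem[].
have [y Py yk] := not_void_event (novoid k).
exists y; last by apply: le_lt_trans ds; exact: cell_diam s0 xk yk.
by rewrite in_fset_set//; apply/mem_set; split=> //; exact: grid_in s0 ms _ yk.
Qed.

Lemma void_cells_le (m n : nat) (h s : R) : sub_poisson_void P Phi -> 0 <= s ->
  (m ^ d)%:R * expR (- s ^+ d) <= n%:R^-1 ->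
  (\sum_(k : {ffun 'I_d -> 'I_m}) P (void_event Phi (cell (corner h s k) s)) <=
    (n%:R^-1)%:E)%E.
Proof.
move=> sub s0 ms; apply: (@le_trans _ _
  (\sum_(k : {ffun 'I_d -> 'I_m}) (expR (- s ^+ d))%:E)%E).
  apply: lee_sum => k _; have := sub _ (bounded_borel_cell (corner h s k) s).
  by rewrite volume_cell.
rewrite sumEFin lee_fin sumr_const card_ffun !card_ord.
by rewrite -[_ *+ _]mulr_natl.
Qed.

Lemma contractible_event (n : nat) (eps : R) : sub_poisson_void P Phi ->
  1 <= ln n%:R :> R -> 16 * d%:R * ln n%:R `^ d%:R^-1 <= eps ->
  exists A : set Omega, [/\ measurable A,
    A `<=` [set omega |
      contractible_complex R (cech (window_points Phi n omega) eps) /\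
      euler_characteristic (cech (window_points Phi n omega) eps) = 1] &
    (1 - (n%:R^-1)%:E <= P A)%E].
Proof.
move=> sub ln1 eps_ge; have [m [s [m0 s0 [ms s_le] msd]]] := grid_size d_gt0 ln1.
pose h : R := n%:R `^ d%:R^-1 / 2.
pose V (k : {ffun 'I_d -> 'I_m}) := void_event Phi (cell (corner h s k) s).
have mV k : measurable (V k) by exact/measurable_void_event/bounded_borel_cell.
have [mU PU] := union_bound P mV.
exists (~` [set omega | exists k, V k omega]); split.
- exact: measurableC.
- move=> omega nV; apply: (no_void_contractible m0 s0 ms) => [|k Vk].
    have dR : 0 < d%:R :> R by rewrite ltr0n.
    have l0 : 0 < ln n%:R `^ d%:R^-1 :> R by apply: powR_gt0; lra.
    have := mulr_gt0 dR l0.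
    have : d%:R * s <= d%:R * (4 * ln n%:R `^ d%:R^-1) by rewrite ler_wpM2l// ltW.
    lra.
  by apply: nV; exists k.
- rewrite probability_setC//; apply: leeB => //.
  exact: le_trans PU (void_cells_le _ sub s0 msd).
Qed.

End HighProbability.

(** [16 * d]: the cells have side at most [4 * (ln n)^(1/d)], hence diameter at
    most [4 * d * (ln n)^(1/d)], which must be less than [r n / 2]. *)
Theorem theorem4p3 (R : realType) (d : nat) (d_gt0 : (0 < d)%N) :
  exists C : R, 0 < C /\
  forall (disp : measure_display) (Omega : measurableType disp)
    (P : probability Omega R) (Phi : point_process R d Omega),
  stationary P Phi -> unit_intensity P Phi -> sub_poisson_void P Phi ->
  forall r : nat -> R,
  (forall n : nat, (0 < n)%N -> C * ln n%:R `^ (d%:R^-1) <= r n) ->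
  with_high_probability P (fun n => [set omega |
    contractible_complex R (cech (window_points Phi n omega) (r n)) /\
    euler_characteristic (cech (window_points Phi n omega) (r n)) = 1]).
Proof.
exists (16 * d%:R); split; first by rewrite mulr_gt0// ltr0n.
move=> disp Omega P Phi _ _ sub r r_ge.
set E := fun n => _.
have HA n : exists A : set Omega, [/\ measurable A, A `<=` E n &
    1 <= ln n%:R :> R -> (1 - (n%:R^-1)%:E <= P A)%E].
  have [ln1|_] := lerP 1 (ln n%:R); last first.
    by exists set0; split=> //; exact: sub0set.
  have n0 : (0 < n)%N by case: n ln1 => //; rewrite ln0// ler10.
  by have [A [mA AE PA]] := contractible_event d_gt0 sub ln1 (r_ge n n0); exists A.
have [A AP] := choice HA; exists A; split=> [n|n|]; try by case: (AP n).
apply: (@squeeze_cvge _ _ _ _ (fun n => (1 - n%:R^-1)%:E) _ (fun=> 1%E));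
  last exact: cvg_cst.
- near=> n; rewrite probability_le1 ?andbT; last by case: (AP n).
  have [_ _] := AP n; rewrite EFinB; apply.
  (* The bound on the void probabilities is used once [ln n >= 1]. *)
  have en : expR 1 <= n%:R :> R by near: n; exact: nbhs_infty_ger.
  by rewrite -[leLHS]expRK ler_ln ?posrE ?expR_gt0// (lt_le_trans (expR_gt0 1)).
- apply: cvg_EFin; first by near=> n.
  rewrite -[X in _ --> X]subr0; apply: cvgB; first exact: cvg_cst.
  apply/gtr0_cvgV0; last exact: cvgr_idn.
  near=> n; rewrite ltr0n; near: n; exact: nbhs_infty_gt.
Unshelve. all: by end_near. Qed.
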